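(* Let $\mathcal{RS}$ be a Riemann solver for a node $J$ with two incoming arcs (indices $1,2$) and two outgoing arcs (indices $3,4$), with flux $f$, and let $(\bar\rho_1,\bar\rho_2,\bar\rho_3,\bar\rho_4)$ be an equilibrium for $\mathcal{RS}$ with $\bar\rho_1\le\bar\rho_2$ and $\bar\rho_3\le\bar\rho_4$. Assume that the equilibrium is composed of two good data and two bad data. 1. Assume that $\bar\rho_2<\sigma$, i.e. the bad data are both in the incoming arcs. If $\mathcal F(\mathcal{RS}(\rho_{1,0},\dots,\rho_{4,0}),k)\ge0$ for every initial datum $(\rho_{1,0},\dots,\rho_{4,0})\in[0,1]^4$ and every $k\in[0,1]$, then $\bar\rho_1\le\bar\rho_3\le\bar\rho_4\le\bar\rho_2$. Conversely, if $\bar\rho_1\le\bar\rho_3\le\bar\rho_4\le\bar\rho_2<\sigma$, then $\mathcal F(\bar\rho_1,\bar\rho_2,\bar\rho_3,\bar\rho_4,k)\ge0$ for every $k\in[0,1]$. 2. Assume that $\bar\rho_3>\sigma$, i.e. the bad data are both in the outgoing arcs. If $\mathcal F(\mathcal{RS}(\rho_{1,0},\dots,\rho_{4,0}),k)\ge0$ for every initial datum $(\rho_{1,0},\dots,\rho_{4,0})\in[0,1]^4$ and every $k\in[0,1]$, then $\bar\rho_3\le\bar\rho_1\le\bar\rho_2\le\bar\rho_4$. Conversely, if $\sigma<\bar\rho_3\le\bar\rho_1\le\bar\rho_2\le\bar\rho_4$, then $\mathcal F(\bar\rho_1,\bar\rho_2,\bar\rho_3,\bar\rho_4,k)\ge0$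 for every $k\in[0,1]$. 3. Assume that $\bar\rho_1<\sigma<\bar\rho_4$, i.e. the bad data are in the arcs with indices $1$ and $4$. If $\mathcal F(\mathcal{RS}(\rho_{1,0},\dots,\rho_{4,0}),k)\ge0$ for every initial datum $(\rho_{1,0},\dots,\rho_{4,0})\in[0,1]^4$ and every $k\in[0,1]$, then $\bar\rho_1\le\bar\rho_3\le\sigma\le\bar\rho_2\le\bar\rho_4$. Conversely, if $\bar\rho_1\le\bar\rho_3\le\sigma\le\bar\rho_2\le\bar\rho_4$, then $\mathcal F(\bar\rho_1,\bar\rho_2,\bar\rho_3,\bar\rho_4,k)\ge0$ for every $k\in[0,1]$.
   Context: Flux: $f:[0,1]\to\mathbb R$ is a continuous, piecewise smooth, concave function with $f(0)=f(1)=0$, and there is a unique $\sigma\in\,]0,1[$ such that $f$ is strictly increasing on $[0,\sigma[$ and strictly decreasing on $]\sigma,1]$. Let $\tau:[0,1]\to[0,1]$ be the map with $f(\tau(\rho))=f(\rho)$ for all $\rho\in[0,1]$ and $\tau(\rho)\neq\rho$ for all $\rho\ne\sigma$. Convention: $\mathrm{sgn}(0)=0$. Riemann solver (two incoming, two outgoing arcs): a function $\mathcal{RS}:[0,1]^4\to[0,1]^4$, $(\rho_{1,0},\dots,\rho_{4,0})\mapsto(\bar\rho_1,\dots,\bar\rho_4)$, such that for every initial datum: (1) $f(\bar\rho_1)+f(\bar\rho_2)=f(\bar\rho_3)+f(\bar\rho_4)$; (2) for $i\in\{1,2\}$ the classical Riemann problem for $\rho_t+f(\rho)_x=0$ with left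 state $\rho_{i,0}$ and right state $\bar\rho_i$ is solved with waves with negative speed; that is, $\bar\rho_i\in\{\rho_{i,0}\}\cup\,]\tau(\rho_{i,0}),1]$ if $\rho_{i,0}\le\sigma$ and $\bar\rho_i\in[\sigma,1]$ if $\rho_{i,0}\ge\sigma$; (3) for $j\in\{3,4\}$ the classical Riemann problem with left state $\bar\rho_j$ and right state $\rho_{j,0}$ is solved with waves with positive speed; that is, $\bar\rho_j\in[0,\sigma]$ if $\rho_{j,0}\le\sigma$ and $\bar\rho_j\in\{\rho_{j,0}\}\cup[0,\tau(\rho_{j,0})[$ if $\rho_{j,0}\ge\sigma$. An equilibrium for $\mathcal{RS}$ is a fixed point of $\mathcal{RS}$. Good and bad data: a datum $\rho$ in an incoming arc is good if $\rho\in[\sigma,1]$ and bad if $\rho\in[0,\sigma[$; a datum $\rho$ in an outgoing arc is good if $\rho\in[0,\sigma]$ and bad if $\rho\in\,]\sigma,1]$. Entropy-flux function: $\mathcal F(\rho_1,\rho_2,\rho_3,\rho_4,k)=\sum_{i=1}^2\mathrm{sgn}(\rho_i-k)(f(\rho_i)-f(k))-\sum_{j=3}^4\mathrm{sgn}(\rho_j-k)(f(\rho_j)-f(k))$. (E1): $\mathcal{RS}$ satisfies (E1) if $\mathcal F(\mathcal{RS}(\rho_{1,0},\dots,\rho_{4,0}),k)\ge0$ for every initial datum $(\rho_{1,0},\dots,\rho_{4,0})\in[0,1]^4$ and every $k\in[0,1]$. *)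

(* Defs.v *)
From mathcomp Require Import all_boot all_order all_algebra.
From mathcomp Require Import all_classical all_reals all_analysis.

Set Implicit Arguments.
Unset Strict Implicit.
Unset Printing Implicit Defensive.

Import Order.TTheory GRing.Theory Num.Theory.
Import numFieldNormedType.Exports.

Local Open Scope classical_set_scope.
Local Open Scope ring_scope.

(* Functions on [0, 1] (resp. [0, 1]^4) are represented by total functions on
   R (resp. R^4); every condition below only constrains them on [0, 1]
   (resp. [0, 1]^4). *)

(* No condition on one-sided limits of the derivatives at the breakpoints:
   this is the most inclusive reading of "piecewise C^oo". *)
Definition piecewise_smooth (R : realType) (a b : R) (f : R -> R) : Prop :=
  exists2 s : seq R, itv_partition a b s &
    forall i : nat, (i < size s)%N ->
    forall (n : nat) (x : R), x \in `](a :: s)`_i, s`_i[ ->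
      derivable (derive1n n f) x 1.

Definition concave_on (R : realType) (D : set R) (f : R -> R) : Prop :=
  convex_function D (fun x => - f x).

Definition turning_point (R : realType) (f : R -> R) (s : R) : Prop :=
  [/\ s \in `]0, 1[,
      {in `[0, s[ &, {homo f : x y / x < y}} &
      {in `]s, 1] &, {homo f : x y /~ x < y}}].

Definition is_flux (R : realType) (f : R -> R) (sigma : R) : Prop :=
  [/\ {within `[0, 1], continuous f},
      piecewise_smooth 0 1 f,
      concave_on `[0, 1] f,
      f 0 = 0 /\ f 1 = 0 &
      unique (turning_point f) sigma].

Definition is_tau (R : realType) (f : R -> R) (sigma : R) (tau : R -> R) :
    Prop :=
  forall r : R, r \in `[0, 1] ->
    [/\ tau r \in `[0, 1], f (tau r) = f r & r <> sigma -> tau r <> r].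

(* [inl _] are the two incoming arcs, [inr _] the two outgoing ones. *)
Notation node_arc := ('I_2 + 'I_2)%type.
Definition arc1 : node_arc := inl ord0.
Definition arc2 : node_arc := inl ord_max.
Definition arc3 : node_arc := inr ord0.
Definition arc4 : node_arc := inr ord_max.

Definition in_cube (R : realType) (r : {ffun node_arc -> R}) : Prop :=
  forall a, r a \in `[0, 1].

(* States reachable at the node from the datum [r0]: the Riemann problem
   [(r0, r)] on an incoming arc is solved with waves of negative speed, the
   Riemann problem [(r, r0)] on an outgoing arc with waves of positive speed.
   At [r0 = sigma] both clauses apply; they agree since [tau sigma = sigma]. *)
Definition admissible_in (R : realType) (sigma : R) (tau : R -> R) (r0 r : R) :
    Prop :=
  (r0 <= sigma -> r = r0 \/ r \in `]tau r0, 1]) /\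
  (sigma <= r0 -> r \in `[sigma, 1]).

Definition admissible_out (R : realType) (sigma : R) (tau : R -> R)
    (r0 r : R) : Prop :=
  (r0 <= sigma -> r \in `[0, sigma]) /\
  (sigma <= r0 -> r = r0 \/ r \in `[0, tau r0[).

Definition riemann_solver (R : realType) (f : R -> R) (sigma : R)
    (tau : R -> R) (RS : {ffun node_arc -> R} -> {ffun node_arc -> R}) :
    Prop :=
  forall r0 : {ffun node_arc -> R}, in_cube r0 ->
    [/\ in_cube (RS r0),
        f (RS r0 arc1) + f (RS r0 arc2) = f (RS r0 arc3) + f (RS r0 arc4),
        forall i : 'I_2, admissible_in sigma tau (r0 (inl i)) (RS r0 (inl i)) &
        forall j : 'I_2, admissible_out sigma tau (r0 (inr j)) (RS r0 (inr j))].

Definition equilibrium (R : realType)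
    (RS : {ffun node_arc -> R} -> {ffun node_arc -> R})
    (r : {ffun node_arc -> R}) : Prop :=
  in_cube r /\ RS r = r.

Definition good (R : realType) (sigma : R) (r : {ffun node_arc -> R})
    (a : node_arc) : bool :=
  match a with
  | inl _ => r a \in `[sigma, 1]
  | inr _ => r a \in `[0, sigma]
  end.

Definition bad (R : realType) (sigma : R) (r : {ffun node_arc -> R})
    (a : node_arc) : bool :=
  match a with
  | inl _ => r a \in `[0, sigma[
  | inr _ => r a \in `]sigma, 1]
  end.

Definition entropy_flux (R : realType) (f : R -> R) (r : {ffun node_arc -> R})
    (k : R) : R :=
  \sum_(i < 2) Num.sg (r (inl i) - k) * (f (r (inl i)) - f k)
  - \sum_(j < 2) Num.sg (r (inr j) - k) * (f (r (inr j)) - f k).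

Definition E1 (R : realType) (f : R -> R)
    (RS : {ffun node_arc -> R} -> {ffun node_arc -> R}) : Prop :=
  forall r0 : {ffun node_arc -> R}, in_cube r0 -> forall k : R, k \in `[0, 1] ->
    0 <= entropy_flux f (RS r0) k.

(* Main.v *)
Require Import Defs.
From mathcomp Require Import all_boot all_order all_algebra.
From mathcomp Require Import all_classical all_reals all_analysis.
From mathcomp Require Import lra.

Set Implicit Arguments.
Unset Strict Implicit.

Import Order.TTheory GRing.Theory Num.Theory.
Import numFieldNormedType.Exports.

Local Open Scope ring_scope.

(** Write [q(x, k) = sgn(x - k) (f x - f k)] for the entropy flux carried by an
    arc in the state [x].  Its value is [f x - f k] for [k <= x] and
    [f k - f x] for [x <= k], so the absolute value of the difference as long
    as [x] and [k] both lie on the increasing branch of the flux, and minus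
    that absolute value on the decreasing branch.

    At an equilibrium the conservation law gives [f1 + f2 = f3 + f4] for the
    four fluxes, and since exactly two data are bad, the bad arcs named in each case
    leave the other two good, which puts every state on a known branch.

    When both bad data are incoming, all four states are on the increasing
    branch.  There the entropy condition reads
    [|f1 - t| + |f2 - t| >= |f3 - t| + |f4 - t|] for every level [t], which,
    the two sums being equal, says exactly that the interval [[f3, f4]] is
    nested in [[f1, f2]]: nestedness suffices by convexity of the absolute
    value, and if it fails the level [t = f1] violates the inequality.  As [f]
    is increasing there, the nesting of the fluxes is that of the states
    ([node_entropy_nested], [nested_node_entropy_ge0]).

    When both bad data are outgoing, all four states are on the decreasing
    branch.  Replacing [f] by [- f] makes the branch increasing, and as the
    entropy flux is odd in [f] the sign is absorbed by exchanging the roles of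
    the incoming and outgoing arcs ([node_entropyN]); the previous argument
    then applies.

    When arcs 1 and 4 are bad, arcs 1 and 3 lie on the increasing branch and
    arcs 2 and 4 on the decreasing one.  At [k = sigma] the entropy flux is
    [(f3 - f1) + (f2 - f4) = 2 (f3 - f1)], whose sign decides the order of the
    states on both branches; conversely, under this order the flux is
    piecewise [0], [2 (f k - f1)], [2 (f3 - f1)], [2 (f k - f4)], [0] as [k]
    crosses [rho1], [rho3], [rho2], [rho4]
    ([node_entropy_crossed], [crossed_node_entropy_ge0]).

    The hypotheses on the flux give strict monotonicity on the half-open
    intervals only; continuity extends it to [sigma], where good states may
    lie. *)

(** * Monotone branches of the flux *)

(** For [x < u], compare [x] with a point in between, whose value is at most
    the left limit [f u]. *)
Lemma homo_lt_itvcc_left (R : realType) (f : R -> R) (l u : R) :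
  {for u, continuous f} ->
  {in `[l, u[ &, {homo f : x y / x < y}} ->
  {in `[l, u] &, {homo f : x y / x < y}}.
Proof.
move=> cf hom x y; rewrite !in_itv /= => /andP[lx xu] /andP[ly yu] xy.
have [yu'|uy] := ltP y u.
  by apply: hom; rewrite ?in_itv /= ?lx ?ly ?yu' ?(lt_trans xy yu').
have yE : y = u by apply/eqP; rewrite eq_le yu uy.
subst y; pose m := (x + u) / 2.
have [xm mu] : x < m /\ m < u by rewrite /m; split; lra.
apply: (@lt_le_trans _ _ (f m)).
  by apply: hom; rewrite ?in_itv //=; apply/andP; split; lra.
have cfu : (f z @[z --> u^'-] --> f u)%classic by exact: cvg_at_left_filter.
apply: (cvgr_to_ge cfu).
near=> z; apply: ltW; apply: hom; rewrite ?in_itv /=.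
- by apply/andP; split; lra.
- apply/andP; split; last by near: z; exact: nbhs_left_lt.
  apply: (@le_trans _ _ m); first lra.
  by near: z; exact: nbhs_left_ge.
- by near: z; exact: nbhs_left_gt.
Unshelve. all: by end_near.
Qed.

(** The reflection [x |-> - x] exchanges the two end points. *)
Lemma homo_lt_itvcc_right (R : realType) (f : R -> R) (l u : R) :
  {for l, continuous f} ->
  {in `]l, u] &, {homo f : x y / x < y}} ->
  {in `[l, u] &, {homo f : x y / x < y}}.
Proof.
move=> cf hom x y xI yI xy.
have hom' : {in `[- u, - l] &, {homo (fun z => - f (- z)) : x y / x < y}}.
  apply: homo_lt_itvcc_left.
    apply: continuousN; apply: continuous_comp; first exact: opp_continuous.
    by rewrite opprK.
  move=> {xI yI xy}x {}y xI yI xy.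
  rewrite ltrN2; apply: hom; rewrite ?ltrN2 //.
    by move: yI; rewrite !in_itv /= => ?; lra.
  by move: xI; rewrite !in_itv /= => ?; lra.
have := hom' (- y) (- x); rewrite !opprK !ltrN2; apply => //.
  by move: yI; rewrite !in_itv /= => ?; lra.
by move: xI; rewrite !in_itv /= => ?; lra.
Qed.

Lemma flux_branches (R : realType) (f : R -> R) (sigma : R) :
  is_flux f sigma ->
  [/\ sigma \in `]0, 1[,
      {in `[0, sigma] &, {mono f : x y / x <= y}} &
      {in `[sigma, 1] &, {mono (\- f) : x y / x <= y}}].
Proof.
move=> [cf _ _ _ [[sI inc dec] _]].
have cfs : {for sigma, continuous f}.
  by have [+ _ _] := (continuous_within_itvP f (@ltr01 R)).1 cf; apply.
split=> //; first exact/le_mono_in/homo_lt_itvcc_left.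
apply/le_mono_in/homo_lt_itvcc_right; first exact: continuousN.
by move=> x y xI yI xy; rewrite /= ltrN2; exact: dec.
Qed.

(** * Counting bad data *)

Lemma card_node_arc (P : pred node_arc) :
  #|[pred a | P a]| = (P arc1 + P arc2 + P arc3 + P arc4)%N.
Proof.
rewrite -sum1_card big_mkcond /= big_sumType /= !big_ord_recr !big_ord0 /=.
have E : widen_ord (leqnSn 1) ord_max = ord0 :> 'I_2 by exact: val_inj.
rewrite !E !add0n !inE /arc1 /arc2 /arc3 /arc4 addnA.
by do 4 case: (P _).
Qed.

Lemma card_bad (R : realType) (s : R) (r : {ffun node_arc -> R}) :
  in_cube r ->
  #|[pred a | bad s r a]| =
  ((r arc1 < s)%R + (r arc2 < s)%R + (s < r arc3)%R + (s < r arc4)%R)%N.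
Proof.
move=> cube.
have badl i : bad s r (inl i) = (r (inl i) < s).
  by have := cube (inl i); rewrite /bad !in_itv /= => /andP[-> _].
have badr j : bad s r (inr j) = (s < r (inr j)).
  by have := cube (inr j); rewrite /bad !in_itv /= => /andP[_ ->]; rewrite andbT.
by rewrite card_node_arc /arc1 /arc2 /arc3 /arc4 !badl !badr.
Qed.

(** * The entropy flux through a node *)

Definition node_entropy (R : realType) (f : R -> R) (x1 x2 y1 y2 k : R) : R :=
  Num.sg (x1 - k) * (f x1 - f k) + Num.sg (x2 - k) * (f x2 - f k)
  - (Num.sg (y1 - k) * (f y1 - f k) + Num.sg (y2 - k) * (f y2 - f k)).

Lemma entropy_fluxE (R : realType) (f : R -> R) (r : {ffun node_arc -> R})
    (k : R) :
  entropy_flux f r k =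
  node_entropy f (r arc1) (r arc2) (r arc3) (r arc4) k.
Proof.
rewrite /entropy_flux !big_ord_recr !big_ord0 /= !add0r.
have E : widen_ord (leqnSn 1) ord_max = ord0 :> 'I_2 by exact: val_inj.
by rewrite !E.
Qed.

Lemma node_entropyN (R : realType) (f : R -> R) (x1 x2 y1 y2 k : R) :
  node_entropy (\- f) y1 y2 x1 x2 k = node_entropy f x1 x2 y1 y2 k.
Proof. by rewrite /node_entropy /=; lra. Qed.

(** This formula and the next agree at [x = k], where both sides vanish, so
    that non-strict comparisons suffice in every case analysis below. *)
Lemma sg_flux_ge (R : realType) (f : R -> R) (x k : R) :
  k <= x -> Num.sg (x - k) * (f x - f k) = f x - f k.
Proof.
rewrite le_eqVlt => /predU1P[->|kx]; first by rewrite !subrr mulr0.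
by rewrite gtr0_sg ?mul1r // subr_gt0.
Qed.

Lemma sg_flux_le (R : realType) (f : R -> R) (x k : R) :
  x <= k -> Num.sg (x - k) * (f x - f k) = f k - f x.
Proof.
rewrite le_eqVlt => /predU1P[->|kx]; first by rewrite !subrr mulr0.
by rewrite ltr0_sg ?mulN1r ?opprB // subr_lt0.
Qed.

(** ** All states on one branch *)

(** If [y1 < x1], conservation forces [x2 < y2], and then the level [k = x1]
    sees the wider pair on the outgoing side. *)
Lemma node_entropy_nested (R : realType) (f : R -> R) (l u x1 x2 y1 y2 : R) :
  {in `[l, u] &, {mono f : x y / x <= y}} ->
  x1 \in `[l, u] -> x2 \in `[l, u] -> y1 \in `[l, u] -> y2 \in `[l, u] ->
  x1 <= x2 -> f x1 + f x2 = f y1 + f y2 ->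
  0 <= node_entropy f x1 x2 y1 y2 x1 ->
  x1 <= y1 /\ y2 <= x2.
Proof.
move=> fm x1I x2I y1I y2I x12 cons ent.
suff fx1y1 : f x1 <= f y1 by rewrite -(fm x1 y1) // -(fm y2 x2) //; split=> //; lra.
rewrite leNgt; apply/negP => y1x1.
have x2y2 : f x2 < f y2 by lra.
have y1x1' : y1 <= x1 by rewrite -fm // ltW.
have x1y2 : x1 <= y2 by apply: le_trans x12 _; rewrite -fm // ltW.
move: ent; rewrite /node_entropy (sg_flux_ge f (lexx x1)) (sg_flux_ge f x12).
by rewrite (sg_flux_le f y1x1') (sg_flux_ge f x1y2); lra.
Qed.

Lemma nested_node_entropy_ge0 (R : realType) (f : R -> R)
    (l u x1 x2 y1 y2 k : R) :
  {in `[l, u] &, {mono f : x y / x <= y}} ->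
  x1 \in `[l, u] -> x2 \in `[l, u] ->
  x1 <= y1 -> y1 <= y2 -> y2 <= x2 -> f x1 + f x2 = f y1 + f y2 ->
  0 <= node_entropy f x1 x2 y1 y2 k.
Proof.
move=> fm x1I x2I x1y1 y12 y2x2 cons; rewrite /node_entropy.
(* Outside [x1, x2] the four terms cancel by conservation, so [k] need not lie
   in the interval of monotonicity. *)
have [kx1|x1k] := leP k x1.
  by rewrite !sg_flux_ge; lra.
have [x2k|kx2] := leP x2 k.
  by rewrite !sg_flux_le; lra.
have kI : k \in `[l, u].
  by move: x1I x2I; rewrite !in_itv /= => /andP[? ?] /andP[? ?];
     apply/andP; split; lra.
have fx1k : f x1 <= f k by rewrite fm // ltW.
have fkx2 : f k <= f x2 by rewrite fm // ltW.
rewrite (sg_flux_le f (ltW x1k)) (sg_flux_ge f (ltW kx2)).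
have [ky1|y1k] := leP k y1.
  by rewrite !sg_flux_ge; lra.
have [y2k|ky2] := leP y2 k.
  by rewrite !sg_flux_le; lra.
have y1I : y1 \in `[l, u].
  by move: kI x1I; rewrite !in_itv /= => /andP[? ?] /andP[? ?];
     apply/andP; split; lra.
have fx1y1 : f x1 <= f y1 by rewrite fm.
by rewrite (sg_flux_le f (ltW y1k)) (sg_flux_ge f (ltW ky2)); lra.
Qed.

(** ** One incoming and one outgoing state on each branch *)

(** The level [k = sigma] separates the branches, and there the entropy flux
    is [2 (f y1 - f x1)]. *)
Lemma node_entropy_crossed (R : realType) (f : R -> R) (l s u x1 x2 y1 y2 : R) :
  {in `[l, s] &, {mono f : x y / x <= y}} ->
  {in `[s, u] &, {mono (\- f) : x y / x <= y}} ->
  x1 \in `[l, s] -> y1 \in `[l, s] -> x2 \in `[s, u] -> y2 \in `[s, u] ->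
  f x1 + f x2 = f y1 + f y2 ->
  0 <= node_entropy f x1 x2 y1 y2 s ->
  x1 <= y1 /\ x2 <= y2.
Proof.
move=> fi fd x1I y1I x2I y2I cons ent.
rewrite -(fi x1 y1) // -(fd x2 y2) //= lerN2.
move: x1I y1I x2I y2I ent; rewrite !in_itv /= /node_entropy.
move=> /andP[_ x1s] /andP[_ y1s] /andP[sx2 _] /andP[sy2 _].
rewrite (sg_flux_le f x1s) (sg_flux_le f y1s) (sg_flux_ge f sx2).
by rewrite (sg_flux_ge f sy2) => ?; split; lra.
Qed.

Lemma crossed_node_entropy_ge0 (R : realType) (f : R -> R)
    (l s u x1 x2 y1 y2 k : R) :
  {in `[l, s] &, {mono f : x y / x <= y}} ->
  {in `[s, u] &, {mono (\- f) : x y / x <= y}} ->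
  x1 \in `[l, s] -> y2 \in `[s, u] ->
  x1 <= y1 -> y1 <= s -> s <= x2 -> x2 <= y2 ->
  f x1 + f x2 = f y1 + f y2 ->
  0 <= node_entropy f x1 x2 y1 y2 k.
Proof.
move=> fi fd; rewrite !in_itv /= /node_entropy.
move=> /andP[lx1 x1s] /andP[sy2 y2u] x1y1 y1s sx2 x2y2 cons.
have [kx1|x1k] := leP k x1.
  by rewrite !sg_flux_ge; lra.
have [y2k|ky2] := leP y2 k.
  by rewrite !sg_flux_le; lra.
rewrite (sg_flux_le f (ltW x1k)) (sg_flux_ge f (ltW ky2)).
have [ky1|y1k] := leP k y1.
  have : f x1 <= f k by rewrite fi ?in_itv /=; lra.
  by rewrite !sg_flux_ge; lra.
rewrite (sg_flux_le f (ltW y1k)).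
have [x2k|kx2] := leP x2 k.
  have : - f k <= - f y2 by rewrite [_ <= _]fd ?in_itv /=; lra.
  by rewrite (sg_flux_le f x2k); lra.
have : f x1 <= f y1 by rewrite fi ?in_itv /=; lra.
by rewrite (sg_flux_ge f (ltW kx2)); lra.
Qed.

(** * Equilibria with two bad data *)

Unset Implicit Arguments.
Set Strict Implicit.

Theorem proposition4p4 (R : realType) (f : R -> R) (sigma : R) (tau : R -> R)
    (RS : {ffun node_arc -> R} -> {ffun node_arc -> R}) (rho : {ffun node_arc -> R})
    (hf : is_flux f sigma) (htau : is_tau f sigma tau)
    (hRS : riemann_solver f sigma tau RS)
    (heq : equilibrium RS rho)
    (h12 : rho arc1 <= rho arc2) (h34 : rho arc3 <= rho arc4)
    (hgood : #|[pred a | good sigma rho a]| = 2%N)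
    (hbad : #|[pred a | bad sigma rho a]| = 2%N) :
  [/\ (rho arc2 < sigma ->
        (E1 f RS ->
          [/\ rho arc1 <= rho arc3, rho arc3 <= rho arc4
            & rho arc4 <= rho arc2]) /\
        ([/\ rho arc1 <= rho arc3, rho arc3 <= rho arc4,
             rho arc4 <= rho arc2 & rho arc2 < sigma] ->
          forall k : R, k \in `[0, 1] -> 0 <= entropy_flux f rho k)),
      (sigma < rho arc3 ->
        (E1 f RS ->
          [/\ rho arc3 <= rho arc1, rho arc1 <= rho arc2
            & rho arc2 <= rho arc4]) /\
        ([/\ sigma < rho arc3, rho arc3 <= rho arc1,
             rho arc1 <= rho arc2 & rho arc2 <= rho arc4] ->
          forall k : R, k \in `[0, 1] -> 0 <= entropy_flux f rho k))
    & (rho arc1 < sigma /\ sigma < rho arc4 ->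
        (E1 f RS ->
          [/\ rho arc1 <= rho arc3, rho arc3 <= sigma,
              sigma <= rho arc2 & rho arc2 <= rho arc4]) /\
        ([/\ rho arc1 <= rho arc3, rho arc3 <= sigma,
             sigma <= rho arc2 & rho arc2 <= rho arc4] ->
          forall k : R, k \in `[0, 1] -> 0 <= entropy_flux f rho k))].
Proof.
have [sI fi fd] := flux_branches hf.
move: sI; rewrite in_itv /= => /andP[s0 s1].
have [cube fixed] := heq.
have [_ cons _ _] := hRS _ cube; rewrite fixed in cons.
have ent k : E1 f RS -> k \in `[0, 1] ->
    0 <= node_entropy f (rho arc1) (rho arc2) (rho arc3) (rho arc4) k.
  by move=> e1 kI; rewrite -entropy_fluxE -fixed; exact: e1.
have := cube arc1; have := cube arc2; have := cube arc3; have := cube arc4.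
rewrite !in_itv /= => /andP[r40 r41] /andP[r30 r31] /andP[r20 r21].
move=> /andP[r10 r11]; have bad2 := hbad; rewrite (card_bad _ cube) in bad2.
split.
- move=> r2s; have r1s := le_lt_trans h12 r2s.
  have [r3s r4s] : rho arc3 <= sigma /\ rho arc4 <= sigma.
    by move: bad2; rewrite r1s r2s; case: (ltP _ (rho arc3)); case: (ltP _ (rho arc4)).
  have r1I : rho arc1 \in `[0, sigma] by rewrite in_itv /= r10 ltW.
  have r2I : rho arc2 \in `[0, sigma] by rewrite in_itv /= r20 ltW.
  split=> [e1|[r13 _ r42 _] k _].
    have [|||r13 r42] := node_entropy_nested fi r1I r2I _ _ h12 cons.
    + by rewrite in_itv /= r30.
    + by rewrite in_itv /= r40.
    + exact: ent e1 (cube _).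
    by split.
  rewrite entropy_fluxE.
  exact: nested_node_entropy_ge0 fi r1I r2I r13 h34 r42 cons.
- move=> sr3; have sr4 := lt_le_trans sr3 h34.
  have [sr1 sr2] : sigma <= rho arc1 /\ sigma <= rho arc2.
    by move: bad2; rewrite sr3 sr4; case: (ltP (rho arc1)); case: (ltP (rho arc2)).
  have r3I : rho arc3 \in `[sigma, 1] by rewrite in_itv /= r31 ltW.
  have r4I : rho arc4 \in `[sigma, 1] by rewrite in_itv /= r41 ltW.
  have consN : (\- f) (rho arc3) + (\- f) (rho arc4) =
               (\- f) (rho arc1) + (\- f) (rho arc2) by rewrite /= -!opprD cons.
  split=> [e1|[_ r31' _ r24] k _].
    have [|||r31' r24] := node_entropy_nested fd r3I r4I _ _ h34 consN.
    + by rewrite in_itv /= sr1.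
    + by rewrite in_itv /= sr2.
    + by rewrite node_entropyN; exact: ent e1 (cube _).
    by split.
  rewrite entropy_fluxE -node_entropyN.
  exact: nested_node_entropy_ge0 fd r3I r4I r31' h12 r24 consN.
- move=> [r1s sr4].
  have [sr2 r3s] : sigma <= rho arc2 /\ rho arc3 <= sigma.
    by move: bad2; rewrite r1s sr4; case: (ltP (rho arc2)); case: (ltP _ (rho arc3)).
  have r1I : rho arc1 \in `[0, sigma] by rewrite in_itv /= r10 ltW.
  have r4I : rho arc4 \in `[sigma, 1] by rewrite in_itv /= r41 ltW.
  split=> [e1|[r13 _ _ r24] k _].
    have [|||r13 r24] := node_entropy_crossed fi fd r1I _ _ r4I cons.
    + by rewrite in_itv /= r30.
    + by rewrite in_itv /= sr2.
    + by apply: ent e1 _; rewrite in_itv /= !ltW.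
    by split.
  rewrite entropy_fluxE.
  exact: crossed_node_entropy_ge0 fi fd r1I r4I r13 r3s sr2 r24 cons.
Qed.
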